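(* Let $\epsilon>0$, $C>0$ and $A\geq 1$. There is a constant $K$, depending only on $\epsilon$, $C$ and $A$, such that the following holds. Let $(X,d,\mu)$ be a complete, geodesic metric measure space such that $\mu$ is a $C$-doubling measure, $\operatorname{diam} X=1$ and $\mu(X)=1$, and let $\mathcal{B}$ be a multiresolution family in $X$ with constant $A$. For any set $E\subseteq X$, if $$\mathcal{B}(E,\epsilon)=\{B\in\mathcal{B}: B\cap E\neq\emptyset,\ \operatorname{sparse}(E,B)\geq \epsilon\},$$ then $$\sum_{B\in\mathcal{B}(E,\epsilon)}\mu(B)\leq K.$$
   Context: $B(x,r)=\{y\in X: d(x,y)\le r\}$ denotes the closed ball; balls are considered together with their center and radius. A metric measure space $(X,d,\mu)$ is a metric space with an (outer) measure $\mu$. A non-zero Borel regular measure $\mu$ is $C$-doubling if it assigns finite measure to every ball and $\mu(B(x,2r))\le C\mu(B(x,r))$ for every ball $B(x,r)\subset X$. $X$ is geodesic if for all $x,y\in X$ there is an isometric embedding $f:[0,d(x,y)]\to X$ with $f(0)=x$ and $f(d(x,y))=y$. For $s>0$, an $s$-net in $X$ is a set $N\subset X$ such that $d(x,y)\ge s$ for all distinct $x,y\in N$, and for every $z\in X$ there is $x\in N$ with $d(x,z)<s$. Given a constant $A\ge 1$ and a nested sequence $N_0\subseteq N_1\subseteq N_2\subseteq\cdots$ where $N_k$ is a $2^{-k}$-net in $X$, the corresponding multiresolution family with constant $A$ is $\mathcal{B}=\{B(x,A\cdot 2^{-k}): x\in N_k,\ 0\le k<\infty\}$. For a set $E\subseteq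 X$ and a closed ball $B$ of radius $r$ with $E\cap B\neq\emptyset$, the sparsity is $$\operatorname{sparse}(E,B)=\frac{\sup\{\operatorname{dist}(x,E\cap B):x\in B\}}{r};$$ it is undefined if $E\cap B=\emptyset$. *)

(* Defs.v *)
From HB Require Import structures.
From mathcomp Require Import all_boot all_order all_algebra.
From mathcomp Require Import all_classical all_reals all_analysis.

Set Implicit Arguments.
Unset Strict Implicit.
Unset Printing Implicit Defensive.

Import Order.TTheory GRing.Theory Num.Theory.

Local Open Scope classical_set_scope.
Local Open Scope ring_scope.

Section MetricNotions.
Context {R : realType} {X : metricType R}.
Implicit Types (x y z : X) (r s : R) (E F : set X).

(* Not the library's [closed_ball], which is the closure of the open ball and
   can be strictly smaller in a general metric space. *)
Definition cball x r : set X := [set y | mdist x y <= r].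

(* A ball together with its center and radius. *)
Definition mball : Type := (X * R)%type.

Definition mball_set (B : mball) : set X := cball B.1 B.2.

(* Meaningful for nonempty F only. *)
Definition dist_set x F : R := inf [set mdist x y | y in F].

Definition diameter E : \bar R :=
  ereal_sup [set z | exists x y, [/\ E x, E y & z = (mdist x y)%:E]].

(* Meaningful only when E meets B; every use is guarded by that condition. *)
Definition sparse E (B : mball) : R :=
  sup [set dist_set x (E `&` mball_set B) | x in mball_set B] / B.2.

Definition is_net s (N : set X) : Prop :=
  (forall x y, N x -> N y -> x <> y -> s <= mdist x y) /\
  (forall z, exists2 x, N x & mdist x z < s).

(* Indexing by (center, radius) keeps apart balls that coincide as sets. *)
Definition multiresolution_family (A : R) (BB : set mball) : Prop :=
  exists N : nat -> set X,
    [/\ forall k, is_net (2 ^- k) (N k),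
        forall k, N k `<=` N k.+1 &
        BB = [set B | exists k x, N k x /\ B = (x, A * 2 ^- k)]].

Definition sparse_balls (BB : set mball) E (eps : R) : set mball :=
  [set B | [/\ BB B, mball_set B `&` E !=set0 & eps <= sparse E B]].

End MetricNotions.

Arguments mball {R} X.

Definition complete_space {R : realType} (X : metricType R) : Prop :=
  forall u : nat -> X, cauchy (u @ \oo) -> exists l : X, u @ \oo --> l.

(* Only the values of f on [0, d(x,y)] are relevant. *)
Definition geodesic_space {R : realType} (X : metricType R) : Prop :=
  forall x y : X, exists f : R -> X,
    [/\ forall s t, 0 <= s <= mdist x y -> 0 <= t <= mdist x y ->
          mdist (f s) (f t) = `|s - t|,
        f 0 = x & f (mdist x y) = y].

Definition borel_set {R : realType} {X : metricType R} : set (set X) :=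
  <<s [set U : set X | open U] >>.

Definition borel_regular {R : realType} {X : metricType R}
    (mu : {outer_measure set X -> \bar R}) : Prop :=
  (forall B, borel_set B -> mu.-caratheodory B) /\
  (forall S : set X, exists B, [/\ borel_set B, S `<=` B & mu S = mu B]).

Definition doubling {R : realType} {X : metricType R} (C : R)
    (mu : {outer_measure set X -> \bar R}) : Prop :=
  [/\ borel_regular mu,
      mu setT <> 0%E,
      forall (x : X) (r : R), 0 < r -> (mu (cball x r) < +oo)%E &
      forall (x : X) (r : R), 0 < r ->
        (mu (cball x (2 * r)) <= C%:E * mu (cball x r))%E].

(* Main.v *)
Require Import Defs.
From mathcomp Require Import all_boot all_order all_algebra.
From mathcomp Require Import all_classical all_reals all_analysis.
From mathcomp Require Import finmap lra.
Import Order.TTheory GRing.Theory Num.Theory.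
Local Open Scope classical_set_scope.
Local Open Scope ring_scope.

(** Assume [eps <= 1], as one may.  A ball [B] of radius [r] on which [E] is
    [eps]-sparse contains a hole: a smaller ball [B'] of radius [delta * r], with
    [delta = eps / 8], all of whose points are at distance at least [delta * r]
    from [E].  They are also within [2 * r] of [E], because [E] meets [B].  So the
    distance to [E] of a point [z] determines, up to a factor [2 / delta], the
    radii of all the sparse balls whose holes contain [z].

    Only boundedly many scales can therefore contribute holes through [z], and
    at each scale only boundedly many balls, because the centers form a net in a
    doubling space.  Hence the holes overlap a bounded number of times and the
    sum of their measures is at most a constant times [mu X = 1].  By doubling,
    [mu B] is at most a constant times [mu B'], which gives the bound.

    [sparse_has_hole] produces the holes (this is where geodesics enter),
    [net_packing] bounds their overlap, and [sum_outer_measure_overlap] turns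
    bounded overlap into a bound on the sum of the measures.  That lemma is also
    used inside [doubling_packing], the volume comparison behind
    [net_packing].  All estimates concern finite lists of balls; an [esum] is by
    definition the supremum of the sums over finite subfamilies. *)

(** * Outer measure of overlapping sets *)

Section OverlappingSets.
Local Open Scope ereal_scope.

(** The integral of [\sum_i \1_(A i)] over [S], done without integration so that
    [S] may be any set.  Cut [S] along the first set [A i]: on [S `&` A i] the
    remaining sets overlap one time fewer, which pays for [mu (S `&` A i)]. *)
Lemma sum_outer_measure_overlap {R : realType} {T I : Type}
    (mu : {outer_measure set T -> \bar R}) (A : I -> set T) (s : seq I)
    (n : nat) (S : set T) :
  (forall i, mu.-caratheodory (A i)) ->
  (forall z, S z -> (count (fun i => `[< A i z >]) s <= n)%N) ->
  \sum_(i <- s) mu (S `&` A i) <= n%:R%:E * mu S.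
Proof.
move=> mA; elim: s n S => [|i s IH] n S ovl.
  by rewrite big_nil mule_ge0 ?outer_measure_ge0.
rewrite big_cons.
have split_sum : \sum_(j <- s) mu (S `&` A j) <=
    \sum_(j <- s) mu (S `&` A i `&` A j) +
    \sum_(j <- s) mu (S `&` ~` A i `&` A j).
  rewrite -big_split/=; apply: lee_sum => j _.
  by rewrite (mA i (S `&` A j)) !(setIAC S (A j)).
have outside : \sum_(j <- s) mu (S `&` ~` A i `&` A j) <=
    n%:R%:E * mu (S `&` ~` A i).
  apply: IH => z [Sz _]; apply: leq_trans (ovl z Sz).
  exact: leq_addl.
(* With no overlap allowed, A i misses S and there is nothing to pay for. *)
case: n => [|n] in ovl outside *.
  have Si0 : S `&` A i = set0.
    rewrite -subset0 => z [Sz Aiz].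
    by have := ovl z Sz; rewrite /= (asboolT Aiz).
  rewrite Si0 outer_measure0 add0e.
  apply: le_trans split_sum _; rewrite big1 ?add0e.
    by apply: le_trans outside _; rewrite !mul0e.
  by move=> j _; rewrite Si0 set0I outer_measure0.
have inside : \sum_(j <- s) mu (S `&` A i `&` A j) <=
    n%:R%:E * mu (S `&` A i).
  apply: IH => z [Sz Aiz].
  by have := ovl z Sz; rewrite /= (asboolT Aiz).
rewrite [in leRHS](mA i S) ge0_muleDr ?outer_measure_ge0//.
have -> : n.+1%:R%:E * mu (S `&` A i) =
    mu (S `&` A i) + n%:R%:E * mu (S `&` A i).
  by rewrite -natr1 EFinD ge0_muleDl ?lee_fin ?ler0n// mul1e addeC.
rewrite -addeA leeD2l//.
by apply: le_trans split_sum _; exact: leeD.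
Qed.

End OverlappingSets.

(** * Closed balls *)

Section Balls.
Context {R : realType} {X : metricType R}.
Implicit Types (x y z : X) (r s : R).

Lemma closed_cball x r : closed (cball x r).
Proof.
rewrite -[cball x r]setCK; apply: open_closedC; rewrite openE => y /negP.
rewrite -ltNge => ry; apply/nbhs_ballP; exists (mdist x y - r) => /=.
  by rewrite subr_gt0.
move=> z; rewrite ballEmdist/= => yz.
apply/negP; rewrite -ltNge.
have := metric_triangle x z y; rewrite (metric_sym z y); lra.
Qed.

Lemma borel_cball x r : borel_set (cball x r).
Proof.
rewrite -[cball x r]setCK -setTD.
apply: sigma_algebraCD; apply: sub_sigma_algebra => /=.
by apply: closed_openC; exact: closed_cball.
Qed.

Lemma cball_sub x y r s :
  mdist x y + r <= s -> cball x r `<=` cball y s.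
Proof.
move=> xy z; rewrite /cball/= => xz.
by have := metric_triangle y x z; rewrite (metric_sym y x); lra.
Qed.

End Balls.

Lemma pow2_unbounded {R : realType} (a : R) : exists n : nat, a <= 2 ^+ n.
Proof. by exists (Num.bound a); exact/ltW/upper_nthrootP. Qed.

(** * Doubling measures *)

Section Doubling.
Context {R : realType} {X : metricType R}.
Context (C : R) (mu : {outer_measure set X -> \bar R}).
Context (C0 : 0 < C) (muD : doubling C mu).
Implicit Types (x y z : X) (r s : R).

Lemma caratheodory_cball x r : mu.-caratheodory (cball x r).
Proof. by case: muD => -[mB _] _ _ _; apply: mB; exact: borel_cball. Qed.

Lemma doubling_iter n x r : 0 < r ->
  (mu (cball x (2 ^+ n * r)) <= (C ^+ n)%:E * mu (cball x r))%E.
Proof.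
case: muD => _ _ _ dbl r0; elim: n => [|n IH].
  by rewrite !expr0 mul1r mul1e.
have r'0 : 0 < 2 ^+ n * r by rewrite mulr_gt0// exprn_gt0.
rewrite exprS -mulrA; apply: le_trans (dbl x _ r'0) _.
by rewrite exprS EFinM -muleA lee_wpmul2l// lee_fin ltW.
Qed.

Lemma doubling_compare n x y r s : 0 < s ->
  cball x r `<=` cball y (2 ^+ n * s) ->
  (mu (cball x r) <= (C ^+ n)%:E * mu (cball y s))%E.
Proof.
move=> s0 sub; apply: le_trans (doubling_iter n y s s0).
exact: le_outer_measure.
Qed.

(** If one ball were null, doubling would make all its dilates null, and
    countably many of them cover the space. *)
Lemma doubling_cball_gt0 x r : 0 < r -> (0 < mu (cball x r))%E.
Proof.
move=> r0; rewrite lt0e outer_measure_ge0 andbT; apply/eqP => mu0.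
have [_ muT _ _] := muD; apply: muT; apply/eqP.
rewrite eq_le outer_measure_ge0 andbT.
have cover : setT `<=` \bigcup_n cball x (2 ^+ n * r).
  move=> y _; have [n dn] := pow2_unbounded (mdist x y / r).
  by exists n => //; rewrite /cball/= -ler_pdivrMr.
apply: (le_trans (le_outer_measure mu _ _ cover)).
apply: (le_trans (outer_measure_sigma_subadditive mu _)).
rewrite eseries0// => n _ _ /=; apply/eqP.
rewrite eq_le outer_measure_ge0 andbT.
by apply: le_trans (doubling_iter n x r r0) _; rewrite mu0 mule0.
Qed.

(** Volume counting: each small ball has measure at least [C ^- n] times that of
    the big ball containing it, and the small balls overlap at most [m] times,
    so their measures add up to at most [m] times that of the big ball, which is
    positive and finite and can be cancelled. *)
Lemma doubling_packing (I : eqType) (t : seq I) (c : I -> X) (s : I -> R)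
    z rho n m :
  0 < rho ->
  (forall i, 0 < s i) ->
  (forall i, i \in t -> cball (c i) (s i) `<=` cball z rho /\
                        cball z rho `<=` cball (c i) (2 ^+ n * s i)) ->
  (forall w, (count (fun i => `[< cball (c i) (s i) w >]) t <= m)%N) ->
  (size t)%:R <= C ^+ n * m%:R.
Proof.
move=> rho0 s0 inout ovl.
have [_ _ mufin _] := muD.
have muz0 := doubling_cball_gt0 z rho rho0.
have muzfin : mu (cball z rho) \is a fin_num.
  by rewrite ge0_fin_numE ?mufin ?outer_measure_ge0.
rewrite -(ler_pM2r (_ : 0 < fine (mu (cball z rho)))); last first.
  by rewrite fine_gt0// muz0 mufin.
rewrite -lee_fin !EFinM !fineK//.
have small : (\sum_(i <- t) mu (cball z rho `&` cball (c i) (s i)) <=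
    m%:R%:E * mu (cball z rho))%E.
  apply: sum_outer_measure_overlap => [i|w _]; last exact: ovl.
  exact: caratheodory_cball.
have big : ((size t)%:R%:E * mu (cball z rho) <=
    (C ^+ n)%:E *
      \sum_(i <- t) mu (cball z rho `&` cball (c i) (s i)))%E.
  elim: t inout {ovl small} => [|i t IH] inout.
    by rewrite big_nil mul0e mule0.
  have [sub sup] := inout i (mem_head i t).
  rewrite big_cons/= -nat1r EFinD ge0_muleDl ?lee_fin ?ler0n// mul1e.
  rewrite ge0_muleDr ?outer_measure_ge0//; last first.
    by apply: sume_ge0 => j _; exact: outer_measure_ge0.
  apply: leeD; last first.
    by apply: IH => j jt; apply: inout; rewrite inE jt orbT.
  by rewrite setIidr//; exact: doubling_compare.
apply: le_trans big _; rewrite -muleA lee_wpmul2l// lee_fin ltW//.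
exact: exprn_gt0.
Qed.

End Doubling.

(** * Overlap of the balls of a multiresolution family *)

Section Nets.
Context {R : realType} {X : metricType R}.

(** Pairs [(x, k)] stand for the balls [cball x (A * 2 ^- k)].  Those that
    contain [z] and have comparable radii all lie near [z] at the scale of the
    largest one, so they can be counted by volume.  The balls
    [cball x (2 ^- k / 3)] serve for this: those of one level are disjoint
    because their centers are [2 ^- k]-separated, and at most [m + 1] levels
    occur, so a point lies in at most [m + 1] of them. *)
Lemma net_packing (C : R) (mu : {outer_measure set X -> \bar R})
    (N : nat -> set X) (A : R) (m n : nat) (z : X) (t : seq (X * nat)) :
  0 < C -> doubling C mu -> 1 <= A ->
  (forall k, is_net (2 ^- k) (N k)) ->
  6 * (A + 1) * 2 ^+ m <= 2 ^+ n ->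
  uniq t ->
  (forall p, p \in t -> N p.2 p.1 /\ mdist p.1 z <= A * 2 ^- p.2) ->
  (forall p q, p \in t -> q \in t -> (2 ^- p.2 : R) <= 2 ^+ m * 2 ^- q.2) ->
  (size t)%:R <= C ^+ n * m.+1%:R.
Proof.
move=> C0 muD A1 netN mn ut Nt scales.
have [->|t0] := eqVneq t [::].
  by rewrite mulr_ge0// exprn_ge0// ltW.
have ex_level : exists k, k \in map snd t.
  by case: (t) t0 => // p u _; exists p.2; rewrite mem_head.
(* The smallest level k0 belongs to the largest ball. *)
case: (ex_minnP ex_level) => k0 /mapP[p0 p0t k0E] k0_min.
have k0_le p : p \in t -> (k0 <= p.2)%N.
  by move=> pt; apply: k0_min; exact: map_f.
have le_k0 p : p \in t -> (p.2 <= k0 + m)%N.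
  move=> pt; have := scales p0 p p0t pt; rewrite -k0E.
  rewrite -ler_pdivrMr ?invr_gt0 ?exprn_gt0// invrK -ler_pdivlMl ?exprn_gt0//.
  by rewrite mulrC invrK -exprD ler_eXn2l ?ltr1n// addnC.
pose rho : R := (A + 1) * 2 ^- k0.
have pow0 k : 0 < 2 ^- k :> R by rewrite invr_gt0 exprn_gt0.
(* The factor 6 * (A + 1) absorbs passing from z to a center, which at most
   doubles rho, and the division by 3 in the small radii. *)
apply: (doubling_packing C mu C0 muD _ t fst (fun p => 2 ^- p.2 / 3)
  z rho n m.+1) => [|p|p pt|w].
- by rewrite mulr_gt0//; lra.
- by rewrite divr_gt0.
- have [_ pz] := Nt p pt.
  have rp : 2 ^- p.2 <= 2 ^- k0 :> R.
    by rewrite lef_pV2 ?posrE ?exprn_gt0// ler_eXn2l ?ltr1n ?k0_le.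
  have r0 := scales p0 p p0t pt; rewrite -k0E in r0.
  have Ap : A * 2 ^- p.2 <= A * 2 ^- k0 by rewrite ler_wpM2l//; lra.
  split; apply: cball_sub; rewrite /rho.
    have := pow0 p.2; lra.
  rewrite (metric_sym z).
  have : 6 * (A + 1) * 2 ^- k0 <= 6 * (A + 1) * (2 ^+ m * 2 ^- p.2).
    by rewrite ler_wpM2l//; lra.
  have : 6 * (A + 1) * 2 ^+ m * 2 ^- p.2 <= 2 ^+ n * 2 ^- p.2.
    by rewrite ler_wpM2r// ltW.
  have := pow0 k0; lra.
- (* The level is injective on the pairs whose small balls contain w. *)
  rewrite -size_filter; set u := [seq p <- t | _].
  have u_level : {in u &, injective snd}.
    move=> [x k] [y l]; rewrite !mem_filter /=.
    move=> /andP[/asboolP xw xt] /andP[/asboolP yw yt] kl; subst l.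
    congr (_, _); apply: contrapT => xy.
    have [/= Nx _] := Nt _ xt; have [/= Ny _] := Nt _ yt.
    have := (netN k).1 x y Nx Ny xy.
    move: xw yw; rewrite /cball/= => xw yw.
    have := metric_triangle x w y; rewrite (metric_sym w y).
    have := pow0 k; lra.
  rewrite -(size_map snd) -(size_iota k0 m.+1); apply: uniq_leq_size.
    by rewrite map_inj_in_uniq// filter_uniq.
  move=> k /mapP[p]; rewrite mem_filter => /andP[_ pt] ->.
  by rewrite mem_iota k0_le// addnS ltnS le_k0.
Qed.

End Nets.

(** * Holes in sparse balls *)

Section Holes.
Context {R : realType} {X : metricType R}.

(** Sparsity gives a point [y] of the ball far from the part of [E] inside the
    ball, but [y] may be near the boundary and [E] may come close to it from
    outside.  Moving [y] a distance [e / 4 * r] along a geodesic to the center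
    leaves it far from [E] inside the ball and makes room for a small ball
    around it, so that points of [E] outside the ball are far away too. *)
Lemma sparse_has_hole (E : set X) (e r : R) (x : X) :
  geodesic_space X -> 0 < e <= 1 -> 0 < r ->
  cball x r `&` E !=set0 -> e <= sparse E (x, r) ->
  exists y, cball y (e / 8 * r) `<=` cball x r /\
    forall z w, cball y (e / 8 * r) z -> E w -> e / 8 * r <= mdist z w.
Proof.
move=> geo /andP[e0 e1] r0 [w0 [xw0 Ew0]].
rewrite /sparse /= ler_pdivlMr// => sp.
have er0 : 0 < e * r by rewrite mulr_gt0.
have er1 : e * r <= r by rewrite ler_piMl// ltW.
have [_ [y xy <-] far] : exists2 d,
    [set dist_set y (E `&` cball x r) | y in cball x r] d & e / 2 * r < d.
  apply: sup_gt; last by apply: lt_le_trans sp; lra.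
  exists (dist_set x (E `&` cball x r)), x => //.
  by rewrite /cball/= mdistxx ltW.
have far_w w : E w -> cball x r w -> e / 2 * r < mdist y w.
  move=> Ew xw; apply: lt_le_trans far _; apply: ge_inf.
    by exists 0 => _ [v _ <-]; exact: mdist_ge0.
  by exists w.
rewrite /cball/= in xy.
(* If y is already that close to the center, the center itself will do. *)
have [y' [yy' xy']] : exists y', mdist y y' <= e / 4 * r /\
    mdist x y' <= r - e / 4 * r.
  have [near|apart] := leP (mdist x y) (e / 4 * r).
    by exists x; rewrite mdistxx (metric_sym y x); split=> //; lra.
  have [f [iso f0 fy]] := geo x y.
  set D := mdist x y in iso fy xy apart; set u := D - e / 4 * r.
  have u0D : 0 <= u <= D by rewrite /u; apply/andP; split; lra.
  have D0D : 0 <= D <= D by apply/andP; split; lra.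
  have z0D : 0 <= (0 : R) <= D by apply/andP; split; lra.
  exists (f u); split.
    by rewrite -fy iso// /u ger0_norm; lra.
  by rewrite -f0 iso// /u sub0r normrN ger0_norm; lra.
exists y'; split.
  by apply: cball_sub; rewrite metric_sym; lra.
move=> z w; rewrite /cball/= => y'z Ew; rewrite leNgt; apply/negP => zw.
have y'w := metric_triangle y' z w.
have : e / 2 * r < mdist y w.
  apply: far_w => //; rewrite /cball/=.
  have := metric_triangle x y' w; lra.
have := metric_triangle y y' w; lra.
Qed.

End Holes.

(** * The sum over sparse balls *)

Section SparseBalls.
Context {R : realType} {X : metricType R}.

(** The bound for finitely many balls, again coded by pairs [(x, k)].  The power
    [2 ^+ m] dominates [2 / (e / 8)], which is both twice the ratio of the
    radius of a ball to that of its hole and the bound on the ratio of the radii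
    of two balls with intersecting holes. *)
Lemma sum_sparse_balls (C A e : R) (mu : {outer_measure set X -> \bar R})
    (N : nat -> set X) (E : set X) (m n P : nat) (t : seq (X * nat)) :
  0 < C -> 1 <= A -> 0 < e <= 1 -> geodesic_space X -> doubling C mu ->
  (forall k, is_net (2 ^- k) (N k)) ->
  16 / e <= 2 ^+ m -> 6 * (A + 1) * 2 ^+ m <= 2 ^+ n ->
  C ^+ n * m.+1%:R <= P%:R ->
  uniq t ->
  (forall p, p \in t -> [/\ N p.2 p.1, cball p.1 (A * 2 ^- p.2) `&` E !=set0
                          & e <= sparse E (p.1, A * 2 ^- p.2)]) ->
  (\sum_(p <- t) mu (cball p.1 (A * 2 ^- p.2)) <=
    (C ^+ m * P%:R)%:E * mu setT)%E.
Proof.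
move=> C0 A1 e01 geo muD netN me mn nP ut tE.
have e0 : 0 < e by case/andP: e01.
pose rad (p : X * nat) : R := A * 2 ^- p.2.
have pow0 k : 0 < 2 ^- k :> R by rewrite invr_gt0 exprn_gt0.
have A0 : 0 < A by lra.
have rad0 p : 0 < rad p by rewrite mulr_gt0.
have hrad0 p : 0 < e / 8 * rad p by rewrite mulr_gt0// divr_gt0.
have wide r : 0 < r -> 2 * r <= 2 ^+ m * (e / 8 * r).
  move=> r0; rewrite mulrA ler_pM2r//.
  by move: me; rewrite ler_pdivrMr//; lra.
have [c hole] : {c : X * nat -> X & forall p, p \in t ->
    cball (c p) (e / 8 * rad p) `<=` cball p.1 (rad p) /\
    forall z w, cball (c p) (e / 8 * rad p) z -> E w ->
      e / 8 * rad p <= mdist z w}.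
  apply: (@boolp.choice _ _ (fun p y => p \in t ->
    cball y (e / 8 * rad p) `<=` cball p.1 (rad p) /\
    forall z w, cball y (e / 8 * rad p) z -> E w ->
      e / 8 * rad p <= mdist z w)) => p.
  have [pt|_] := boolP (p \in t); last by exists p.1.
  have [_ BE sp] := tE p pt.
  have [y ?] := sparse_has_hole E e (rad p) p.1 geo e01 (rad0 p) BE sp.
  by exists y.
have ball_hole p : p \in t -> (mu (cball p.1 (rad p)) <=
    (C ^+ m)%:E * mu (cball (c p) (e / 8 * rad p)))%E.
  move=> pt; have [sub _] := hole p pt.
  apply: (doubling_compare C mu C0 muD) => //; apply: cball_sub.
  have : cball p.1 (rad p) (c p) by apply: sub; rewrite /cball/= mdistxx ltW.
  by have := wide (rad p) (rad0 p); rewrite /cball/=; lra.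
have ovl z : (count (fun p => `[< cball (c p) (e / 8 * rad p) z >]) t <= P)%N.
  rewrite -(ler_nat R); apply: le_trans nP; rewrite -size_filter.
  have uz := filter_uniq (fun p => `[< cball (c p) (e / 8 * rad p) z >]) ut.
  apply: (net_packing C mu N A m n z _ C0 muD A1 netN mn uz) => [p|p q].
    rewrite mem_filter => /andP[/asboolP pz pt]; have [sub _] := hole p pt.
    by split; [have [] := tE p pt | exact: sub].
  rewrite !mem_filter => /andP[/asboolP pz pt] /andP[/asboolP qz qt].
  (* A point w of E in the ball q is at most two radii of q away from z, but at
     least the radius of the hole of p away from it. *)
  have [_ farp] := hole p pt; have [subq _] := hole q qt.
  have [_ [w [qw Ew]] _] := tE q qt.
  have zq : mdist q.1 z <= rad q by exact: subq.
  have zw : e / 8 * rad p <= 2 * rad q.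
    apply: le_trans (farp z w pz Ew) _.
    have := metric_triangle z q.1 w; rewrite (metric_sym z q.1).
    by move: qw; rewrite /cball/= -/(rad q); lra.
  have pq : 2 * rad p <= 2 ^+ m * (2 * rad q).
    apply: le_trans (wide _ (rad0 p)) _.
    by rewrite ler_wpM2l// exprn_ge0.
  rewrite -(ler_pM2l A0) mulrCA -/(rad p) -/(rad q); lra.
apply: (@le_trans _ _
    (\sum_(p <- t) (C ^+ m)%:E * mu (cball (c p) (e / 8 * rad p)))%E).
  by rewrite !big_seq; apply: lee_sum => p pt; exact: ball_hole.
rewrite -ge0_sume_distrr; last by move=> p _; exact: outer_measure_ge0.
rewrite EFinM -muleA lee_wpmul2l ?lee_fin ?exprn_ge0 ?(ltW C0)//.
under eq_bigr do rewrite -[cball _ _]setTI.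
apply: sum_outer_measure_overlap => [p|z _]; last exact: ovl.
exact: (caratheodory_cball C mu muD).
Qed.

End SparseBalls.

Theorem theorem1p4 (R : realType) (eps C A : R)
    (eps_gt0 : 0 < eps) (C_gt0 : 0 < C) (A_ge1 : 1 <= A) :
  exists K : R,
    forall (X : metricType R) (mu : {outer_measure set X -> \bar R})
      (BB : set (mball X)),
      complete_space X ->
      geodesic_space X ->
      doubling C mu ->
      diameter [set: X] = 1%E ->
      mu [set: X] = 1%E ->
      multiresolution_family A BB ->
      forall E : set X,
        (\esum_(B in sparse_balls BB E eps) mu (mball_set B) <= K%:E)%E.
Proof.
(* Lowering eps only enlarges the family, and e <= 1 makes the holes fit. *)
pose e := Num.min eps 1.
have e01 : 0 < e <= 1 by rewrite /e lt_min eps_gt0 ltr01 ge_min lexx orbT.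
have [m me] := pow2_unbounded (16 / e).
have [n mn] := pow2_unbounded (6 * (A + 1) * 2 ^+ m).
pose P := Num.bound (C ^+ n * m.+1%:R).
have nP : C ^+ n * m.+1%:R <= P%:R.
  by apply/ltW/archi_boundP; rewrite mulr_ge0// exprn_ge0// ltW.
exists (C ^+ m * P%:R) => X mu BB _ geo muD _ muT [N [netN _ ->]] E.
apply: ge_ereal_sup => _ [F [finF FE] <-].
(* A ball of the family is recovered from its center and a level. *)
have [lev levP] : {lev : mball X -> nat & forall B, F B ->
    N (lev B) B.1 /\ B = (B.1, A * 2 ^- lev B)}.
  apply: (@boolp.choice _ _ (fun B k => F B ->
    N k B.1 /\ B = (B.1, A * 2 ^- k))) => B.
  have [FB|] := pselect (F B); last by exists 0%N.
  by have [[k [x [Nx ->]]] _ _] := FE B FB; exists k.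
rewrite fsbig_finite//=; set s := fset_set F.
have sF B : B \in s -> F B by rewrite in_fset_set// => /set_mem.
pose t := [seq (B.1, lev B) | B <- s].
have -> : (\sum_(B <- s) mu (mball_set B) =
    \sum_(p <- t) mu (cball p.1 (A * 2 ^- p.2)))%E.
  rewrite big_map !big_seq; apply: eq_bigr => B /sF FB.
  by have [_ {1}->] := levP B FB.
rewrite -[leRHS]mule1 -muT.
apply: (sum_sparse_balls C A e mu N E m n P t) => //.
  rewrite map_inj_in_uniq ?fset_uniq// => B B' /sF FB /sF FB' [cE lE].
  have [_ ->] := levP B FB; have [_ ->] := levP B' FB'.
  by rewrite cE lE.
move=> _ /mapP[B /sF FB ->] /=.
have [NB BE] := levP B FB; have [_ ne sp] := FE B FB.
rewrite -BE; split=> //; first by rewrite BE in ne.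
by apply: le_trans sp; rewrite /e ge_min lexx.
Qed.
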